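(* Let $\mathbf{W}$ be the Markov chain on $G \wr S_n$ (state space $G^n \times S_n$) described in the context, built from $P$ and $\widehat{Q}$ and started at $(\vec{x}_0; e)$ with $\vec{x}_0 = (\chi_1, \ldots, \chi_n) \in G^n$, with transition matrix $\mathbf{P}$ and stationary distribution $\mathbf{P}^{\infty}$. Then for every integer $k \geq 1$, $$\| \mathbf{P}^{k}((\vec{x}_0;e), \cdot) - \mathbf{P}^{\infty}(\cdot) \|_{\mathrm{TV}}^2 \;\leq\; \tfrac14 \, \| \mathbf{P}^k((\vec{x}_0;e), \cdot) - \mathbf{P}^{\infty}(\cdot) \|_2^2$$ and $$\tfrac14 \, \| \mathbf{P}^k((\vec{x}_0;e), \cdot) - \mathbf{P}^{\infty}(\cdot) \|_2^2 \;=\; \tfrac14 \sum_{J \subseteq [n]} \frac{n!}{|J|!} \left[ \prod_{i \in [n]\setminus J} \left( \frac{1}{p_{\chi_i}} - 1 \right) \right] \mu_n(J)^{2k} \, d_k(J) \;+\; \tfrac14 \sum_{J \subsetneq [n]} \frac{n!}{|J|!} \left[ \prod_{i \in [n]\setminus J} \left( \frac{1}{p_{\chi_i}} - 1 \right) \right] \mu_n(J)^{2k}.$$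
   Context: Let $n \geq 1$ be an integer, $[n] = \{1,\ldots,n\}$, $S_n$ the symmetric group on $[n]$ with identity $e$, and for $\pi \in S_n$ let $F(\pi) \subseteq [n]$ be its set of fixed points. An augmented permutation is a pair $\hat{\pi} = (\pi, J)$ with $\pi \in S_n$ and $J \subseteq F(\pi)$; $\widehat{S}_n$ is the set of all of them. Put $T(\pi,J) := \pi$ and $I(\pi,J) := ([n] \setminus F(\pi)) \cup J$. $\widehat{Q}$ is a probability measure on $\widehat{S}_n$ that is augmented symmetric: $\widehat{Q}(\pi,J) = \widehat{Q}(\pi^{-1},J)$ for all $\pi \in S_n$ and $J \subseteq F(\pi) = F(\pi^{-1})$. Let $Q$ be the image of $\widehat{Q}$ under $T$; it is assumed that $Q$ is not concentrated on a proper subgroup of $S_n$ or a coset of one. $G$ is a finite group (its group structure plays no role), $P$ is a probability measure on $G$, $p_g := P(g)$ for $g \in G$, and $p_{\min} := \min_{g \in G} p_g$ is assumed to be $> 0$. The chain: let $\hat{\xi}_1, \hat{\xi}_2, \ldots$ be independent with law $\widehat{Q}$, and $\xi_k := T(\hat{\xi}_k)$. Set $Y_0 := e$, $Y_k := \xi_k \xi_{k-1} \cdots \xi_1$. Set $X_0 := \vec{x}_0 = (\chi_1,\ldots,\chi_n) \in G^n$; at step $k \geq 1$, the entries of $X_{k-1}$ at the indices in $I(\hat{\xi}_k)$ are independently replaced by elements of $G$ with law $P$ (independently of everything else), the other entries being unchanged, to give $X_k$. The Markov chain is $\mathbf{W} = (W_k)_{k\ge 0}$, $W_k := (X_k; Y_k)$.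 Its transition matrix is $$\mathbf{P}((\vec{x};\pi),(\vec{y};\sigma)) = \sum_{\hat{\rho} \in \widehat{S}_n:\, T(\hat{\rho}) = \sigma\pi^{-1}} \widehat{Q}(\hat{\rho}) \prod_{j \in I(\hat{\rho})} p_{y_j} \prod_{\ell \notin I(\hat{\rho})} \mathbb{I}(x_\ell = y_\ell),$$ and its stationary distribution is $\mathbf{P}^{\infty}(\vec{x};\pi) = \frac{1}{n!}\prod_{i=1}^n p_{x_i}$. Norms: for a signed measure $\nu$ on $G^n \times S_n$, $\|\nu\|_2^2 := \sum_{w} \nu(w)^2 / \mathbf{P}^{\infty}(w)$. For probability measures $\nu_1,\nu_2$, $\|\nu_1 - \nu_2\|_{\mathrm{TV}} := \max_A |\nu_1(A) - \nu_2(A)|$. For $J \subseteq [n]$ let $\mu_n(J) := \widehat{Q}\{\hat{\sigma} \in \widehat{S}_n : I(\hat{\sigma}) \subseteq J\}$ and let $S_{(J)}$ be the subgroup of all $\sigma \in S_n$ with $[n] \setminus F(\sigma) \subseteq J$. When $\mu_n(J) > 0$, $Q_{S_{(J)}}$ is the probability measure on $S_{(J)}$ which is the law of $T(\hat{\pi})$ when $\hat{\pi}$ has law $\widehat{Q}$ conditioned on $I(\hat{\pi}) \subseteq J$; $Q_{S_{(J)}}^{*k}$ is its $k$-fold convolution power and $U_{S_{(J)}}$ is the uniform distribution on $S_{(J)}$. Define $$d_k(J) := |J|! \sum_{\sigma \in S_{(J)}} \left( Q_{S_{(J)}}^{*k}(\sigma) - U_{S_{(J)}}(\sigma) \right)^2,$$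 with $d_k(J) := 0$ if $\mu_n(J) = 0$. Empty products equal $1$. *)

(* Defs.v *)
From mathcomp Require Import all_boot all_order all_algebra all_fingroup.

Set Implicit Arguments.
Unset Strict Implicit.
Unset Printing Implicit Defensive.

Import Order.TTheory GRing.Theory Num.Theory.

Local Open Scope ring_scope.

(* The index set [n] is 'I_n.  Measures on a finite type are given by their
   mass functions. *)

Definition is_prob (R : realFieldType) (T : finType) (mu : T -> R) : Prop :=
  (forall t, 0 <= mu t) /\ \sum_t mu t = 1.

Definition measure_of (R : realFieldType) (T : finType) (mu : T -> R)
  (A : {set T}) : R := \sum_(t in A) mu t.

Definition tv_dist (R : realFieldType) (T : finType) (mu nu : T -> R) : R :=
  \big[Num.max/0]_(A : {set T}) `|measure_of mu A - measure_of nu A|.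

Definition sq_norm2 (R : realFieldType) (T : finType) (pi nu : T -> R) : R :=
  \sum_t nu t ^+ 2 / pi t.

Definition min_mass (R : realFieldType) (G : finGroupType) (p : G -> R) : R :=
  \big[Num.min/p 1%g]_(g : G) p g.

Definition conv (R : realFieldType) (gT : finGroupType) (mu nu : gT -> R) :
  gT -> R := fun x => \sum_y mu (x * y^-1)%g * nu y.

Definition conv_pow (R : realFieldType) (gT : finGroupType) (mu : gT -> R)
  (k : nat) : gT -> R := iter k (conv mu) (fun x => (x == 1%g)%:R).

Definition fixpts (n : nat) (s : 'S_n) : {set 'I_n} := [set i | s i == i].

Lemma fixptsV (n : nat) (s : 'S_n) : fixpts s^-1%g = fixpts s.
Proof.
by apply/setP=> i; rewrite !inE -(inj_eq (@perm_inj _ s)) permKV eq_sym.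
Qed.

Definition aug_perm (n : nat) :=
  {u : 'S_n * {set 'I_n} | u.2 \subset fixpts u.1}.

Definition augT (n : nat) (u : aug_perm n) : 'S_n := (val u).1.

Definition augJ (n : nat) (u : aug_perm n) : {set 'I_n} := (val u).2.

Definition augI (n : nat) (u : aug_perm n) : {set 'I_n} :=
  ~: fixpts (augT u) :|: augJ u.

Lemma aug_inv_subproof (n : nat) (u : aug_perm n) :
  augJ u \subset fixpts (augT u)^-1%g.
Proof. by rewrite fixptsV; exact: (valP u). Qed.

Definition aug_inv (n : nat) (u : aug_perm n) : aug_perm n :=
  exist _ ((augT u)^-1%g, augJ u) (aug_inv_subproof u).

Definition aug_symmetric (R : realFieldType) (n : nat)
  (Qhat : aug_perm n -> R) : Prop :=
  forall u, Qhat u = Qhat (aug_inv u).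

Definition imageT (R : realFieldType) (n : nat) (Qhat : aug_perm n -> R) :
  'S_n -> R := fun s => \sum_(u : aug_perm n | augT u == s) Qhat u.

Definition concentrated_on (R : realFieldType) (T : finType) (mu : T -> R)
  (A : {set T}) : Prop := measure_of mu A = 1.

(* The subgroup itself is its coset by 1. *)
Definition not_on_proper_coset (R : realFieldType) (gT : finGroupType)
  (mu : gT -> R) : Prop :=
  forall (H : {group gT}) (s : gT), H \proper [set: gT] ->
    ~ concentrated_on mu (s *: H)%g /\ ~ concentrated_on mu (H :* s)%g.

Definition state (G : finGroupType) (n : nat) : finType :=
  ({ffun 'I_n -> G} * 'S_n)%type.

Definition trans_prob (R : realFieldType) (G : finGroupType) (n : nat)
  (p : G -> R) (Qhat : aug_perm n -> R) (v w : state G n) : R :=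
  \sum_(r : aug_perm n | augT r == (w.2 * v.2^-1)%g)
    Qhat r * (\prod_(j in augI r) p (w.1 j))
           * (\prod_(l | l \notin augI r) (v.1 l == w.1 l)%:R).

(* MathComp's product of permutations applies the left factor first; writing
   (w.2 * v.2^-1) above in the opposite order would not change the k-step law
   from (x; 1), since the increments are i.i.d. and their sets I are merely
   united. *)

Definition trans_mx (R : realFieldType) (G : finGroupType) (n : nat)
  (p : G -> R) (Qhat : aug_perm n -> R) : 'M[R]_#|state G n| :=
  \matrix_(a, b) trans_prob p Qhat (enum_val a) (enum_val b).

Definition kstep (R : realFieldType) (G : finGroupType) (n : nat)
  (p : G -> R) (Qhat : aug_perm n -> R) (k : nat) (v w : state G n) : R :=
  (trans_mx p Qhat ^+ k) (enum_rank v) (enum_rank w).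

Definition stationary (R : realFieldType) (G : finGroupType) (n : nat)
  (p : G -> R) (w : state G n) : R :=
  (n`!%:R)^-1 * \prod_(i < n) p (w.1 i).

Definition mu_n (R : realFieldType) (n : nat) (Qhat : aug_perm n -> R)
  (J : {set 'I_n}) : R := \sum_(u : aug_perm n | augI u \subset J) Qhat u.

(* The subgroup S_(J) is MathComp's [Sym J].  Measures on it are extended by 0
   to all of 'S_n, so that their convolution is the one of 'S_n. *)

Definition Q_cond (R : realFieldType) (n : nat) (Qhat : aug_perm n -> R)
  (J : {set 'I_n}) : 'S_n -> R := fun s =>
  (\sum_(u : aug_perm n | (augT u == s) && (augI u \subset J)) Qhat u)
    / mu_n Qhat J.

Definition unif_Sym (R : realFieldType) (n : nat) (J : {set 'I_n}) :
  'S_n -> R := fun s => if s \in Sym J then (#|Sym J|%:R)^-1 else 0.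

Definition d_ (R : realFieldType) (n : nat) (Qhat : aug_perm n -> R)
  (k : nat) (J : {set 'I_n}) : R :=
  if mu_n Qhat J == 0 then 0
  else #|J|`!%:R *
    \sum_(s in Sym J) (conv_pow (Q_cond Qhat J) k s - unif_Sym R J s) ^+ 2.

(* Main.v *)
Require Import Defs.
From mathcomp Require Import all_boot all_order all_algebra all_fingroup.
From mathcomp Require Import ring lra.

Set Implicit Arguments.
Unset Strict Implicit.
Unset Printing Implicit Defensive.

Import Order.TTheory GRing.Theory Num.Theory.

Local Open Scope ring_scope.

(** Refreshing the coordinates in a set [I] is a tensor product of
    one-coordinate kernels, each of which either replaces a coordinate by a
    fresh sample of [p] or keeps it.  Both kernels act diagonally on the two
    one-coordinate signed measures [p] and [dirac (chi i) - p]: the first one is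
    preserved by both, while the second one, having total mass 0, is killed by
    a refreshment and preserved otherwise.  Hence the tensor products [mode J],
    with [p] at the coordinates in [J] and [dirac (chi i) - p] at the others,
    are simultaneous eigenvectors of all refreshments: refreshing [I] preserves
    [mode J] if [I] is contained in [J] and kills it otherwise
    ([refresh_mode]).

    The initial law, a Dirac mass at [chi], is the sum of all the modes
    ([sum_mode_dirac]).  Along the chain the coefficient of [mode J] is
    therefore only fed by the steps whose refreshed set lies in [J], and after
    [k] steps it is the [k]-th convolution power of [restr_law Qhat J], the law
    of the permutation restricted to the event that the refreshed set lies in
    [J] ([kstep_mode]).  The stationary law is the mode of the full set divided
    by [n!], so it only alters one coefficient.

    The modes are orthogonal for the weight [1 / prod p], with square norms
    [prod_(i notin J) (1 / p (chi i) - 1)] ([mode_orthogonal]).  By Pythagoras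
    the square norm of the difference is a sum over [J] of these products times
    the sum of squares of a coefficient.  Since [restr_law Qhat J] is
    [mu_n Qhat J] times a probability measure on [Sym J], and the sum of squares
    of a probability measure exceeds its square distance to the uniform one by
    [1 / |J|!], the sum of squares is
    [mu_n Qhat J ^+ (2 * k) * (d_ Qhat k J + 1) / |J|!] ([sum_restr_law_sq]).
    For the full set, subtracting the stationary law removes exactly the
    summand 1, which is why the last sum ranges over proper subsets.

    The bound on total variation is the nonnegativity of a variance
    ([tv_sq_le_norm2]). *)

(** * Total variation and the weighted quadratic norm *)

(** As [nu = mu - pi] has total mass 0, [2 nu(A)] is the sum of [e * nu], where
    [e] is 1 on [A] and -1 off [A].  This is the mean under [pi] of
    [e * nu / pi], whose second moment is the quadratic norm, since [e ^+ 2] is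
    1.  A squared mean is at most the second moment. *)
Lemma tv_sq_le_norm2 (R : realFieldType) (T : finType) (pi mu : T -> R)
    (pi_gt0 : forall t, 0 < pi t) (pi1 : \sum_t pi t = 1)
    (mu1 : \sum_t mu t = 1) :
  tv_dist mu pi ^+ 2 <= 4^-1 * sq_norm2 pi (fun t => mu t - pi t).
Proof.
pose nu t := mu t - pi t; rewrite -/nu.
have nu0 : \sum_t nu t = 0 by rewrite sumrB mu1 pi1 subrr.
have norm_ge0 : 0 <= sq_norm2 pi nu.
  by apply: sumr_ge0 => t _; rewrite divr_ge0 ?sqr_ge0 ?ltW.
apply: (big_ind (fun a => a ^+ 2 <= 4^-1 * sq_norm2 pi nu)).
- by rewrite expr0n /= mulr_ge0 ?invr_ge0.
- by move=> a b ha hb; rewrite maxEle; case: ifP.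
move=> A _.
rewrite real_normK ?num_real // /measure_of -sumrB -/nu.
pose e t : R := (-1) ^+ (t \notin A).
have m_def : \sum_t e t * nu t = 2 * \sum_(t in A) nu t.
  have := nu0; rewrite (bigID (mem A)) /= => h.
  rewrite (bigID (mem A)) /=.
  rewrite (eq_bigr nu); last by move=> t tA; rewrite /e tA mul1r.
  rewrite [X in _ + X](eq_bigr (fun t => - nu t)); last first.
    by move=> t tA; rewrite /e tA mulN1r.
  rewrite sumrN; lra.
move: (\sum_(t in A) nu t) m_def => m m_def.
(* The variance of [e * nu / pi], whose mean is [2 * m]. *)
have : 0 <= \sum_t (e t * nu t / pi t - 2 * m) ^+ 2 * pi t.
  by apply: sumr_ge0 => t _; rewrite mulr_ge0 ?sqr_ge0 ?ltW.
have -> : \sum_t (e t * nu t / pi t - 2 * m) ^+ 2 * pi t =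
    sq_norm2 pi nu - 4 * m * (\sum_t e t * nu t) + 4 * m ^+ 2 * \sum_t pi t.
  rewrite /sq_norm2 !mulr_sumr -sumrB -big_split /=; apply: eq_bigr => t _.
  have -> : nu t ^+ 2 = (e t * nu t) ^+ 2 by rewrite exprMn sqrr_sign mul1r.
  by field; rewrite gt_eqF.
rewrite m_def pi1; lra.
Qed.

(** * Convolution powers on a finite group *)

Section Convolution.

Variables (R : realFieldType) (gT : finGroupType).
Implicit Types (mu nu : gT -> R) (k : nat).

Lemma sum_mulgV (f : gT -> R) y : \sum_x f (x * y^-1)%g = \sum_x f x.
Proof. by rewrite [RHS](reindex_inj (mulIg y^-1)%g). Qed.

Lemma conv_powS mu k x :
  conv_pow mu k.+1 x = \sum_y mu (x * y^-1)%g * conv_pow mu k y.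
Proof. by []. Qed.

Lemma conv_pow_mass mu k :
  \sum_x conv_pow mu k x = (\sum_x mu x) ^+ k.
Proof.
elim: k => [|k IHk].
  rewrite expr0 (bigD1 1%g) //= eqxx big1 ?addr0 // => x /negPf xn1.
  by rewrite /conv_pow /= xn1.
under eq_bigr do rewrite conv_powS.
rewrite exchange_big exprS -IHk mulr_sumr /=; apply: eq_bigr => y _.
by rewrite -mulr_suml sum_mulgV.
Qed.

Lemma conv_pow_scale mu (c : R) k x :
  conv_pow (fun y => c * mu y) k x = c ^+ k * conv_pow mu k x.
Proof.
elim: k x => [|k IHk] x; first by rewrite expr0 mul1r.
rewrite !conv_powS mulr_sumr; apply: eq_bigr => y _.
by rewrite IHk exprS; ring.
Qed.

Lemma eq_conv_pow mu nu k : mu =1 nu -> conv_pow mu k =1 conv_pow nu k.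
Proof.
move=> eq_mu; elim: k => [|k IHk] x //.
by rewrite !conv_powS; apply: eq_bigr => y _; rewrite eq_mu IHk.
Qed.

Lemma conv_pow_supp (H : {group gT}) mu k x :
  (forall y, y \notin H -> mu y = 0) -> x \notin H -> conv_pow mu k x = 0.
Proof.
move=> mu0; elim: k x => [|k IHk] x xH.
  by rewrite /conv_pow /=; case: eqP xH => // ->; rewrite group1.
rewrite conv_powS big1 // => y _.
have [yH|/IHk->] := boolP (y \in H); last by rewrite mulr0.
by rewrite mu0 ?mul0r // groupMr ?groupV.
Qed.

End Convolution.

(** * Refreshing coordinates of a product space *)

Section Modes.

Variables (R : realFieldType) (n : nat) (G : finGroupType).
Variables (p : G -> R) (chi : {ffun 'I_n -> G}).
Hypothesis p_sum1 : \sum_g p g = 1.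
Implicit Types (I J K : {set 'I_n}) (x y : {ffun 'I_n -> G}).

Definition refresh I x y : R :=
  \prod_i (if i \in I then p (y i) else (x i == y i)%:R).

(** The tensor product of [p] over [J] and of the centred Dirac masses
    [dirac (chi i) - p] over the complement of [J]. *)
Definition mode J y : R :=
  \prod_i (if i \in J then p (y i) else (y i == chi i)%:R - p (y i)).

Lemma sum_ffun_prod (f : 'I_n -> G -> R) :
  \sum_(y : {ffun 'I_n -> G}) \prod_i f i (y i) = \prod_i \sum_g f i g.
Proof. by rewrite bigA_distr_bigA. Qed.

(** Expanding the tensor product of [dirac (chi i) = p + (dirac (chi i) - p)]
    produces every mode once. *)
Lemma sum_mode_dirac y : \sum_J mode J y = (y == chi)%:R.
Proof.
rewrite /mode -(bigA_distr 1 _ (fun i => p (y i))) /=.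
under eq_bigr do rewrite addrC subrK.
have [->|y_neq] := eqVneq y chi; first by rewrite big1 // => i; rewrite eqxx.
have [i yi] : exists i, y i != chi i.
  apply/existsP; rewrite -negb_forall; apply: contraNN y_neq => /forallP h.
  by apply/eqP/ffunP => i; apply/eqP.
by rewrite (bigD1 i) //= (negPf yi) mul0r.
Qed.

Lemma sum_eq_mul (f : G -> R) (a : G) : \sum_g f g * (g == a)%:R = f a.
Proof.
rewrite (bigD1 a) //= eqxx mulr1 big1 ?addr0 // => g /negPf->.
by rewrite mulr0.
Qed.

Lemma sum_dirac_sub (a : G) : \sum_g ((g == a)%:R - p g) = 0.
Proof.
rewrite sumrB p_sum1 -[X in X - 1](eq_bigr _ (fun g _ => mul1r _)).
by rewrite (sum_eq_mul (fun=> 1)) subrr.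
Qed.

(** The sum factors over coordinates.  A coordinate of [I] outside [J]
    contributes the total mass of [dirac (chi i) - p], which is 0; every other
    coordinate reproduces its factor. *)
Lemma refresh_mode I J y :
  \sum_x mode J x * refresh I x y = if I \subset J then mode J y else 0.
Proof.
pose f i g := (if i \in J then p g else (g == chi i)%:R - p g) *
  (if i \in I then p (y i) else (g == y i)%:R).
transitivity (\prod_i \sum_g f i g).
  by rewrite -sum_ffun_prod; apply: eq_bigr => x _; rewrite -big_split.
case: ifPn => [/subsetP IJ|/subsetPn[i iI iJ]].
  apply: eq_bigr => i _; rewrite /f; have := IJ i.
  case: (i \in I); case: (i \in J) => // IJi; try by have := IJi isT.
  - by rewrite -mulr_suml p_sum1 mul1r.
  - by rewrite sum_eq_mul.
  - by rewrite (sum_eq_mul (fun g => (g == chi i)%:R - p g)).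
rewrite (bigD1 i) //= /f iI (negPf iJ) -mulr_suml sum_dirac_sub.
by rewrite !mul0r.
Qed.

Lemma mode_mass J : \sum_y mode J y = (J == [set: 'I_n])%:R.
Proof.
rewrite (sum_ffun_prod
  (fun i g => if i \in J then p g else (g == chi i)%:R - p g)).
have [->|] := eqVneq J setT.
  by rewrite big1 // => i _; under eq_bigr do rewrite inE.
rewrite -subTset => /subsetPn[i _ iJ].
by rewrite (bigD1 i) //= (negPf iJ) sum_dirac_sub mul0r.
Qed.

(** In one coordinate, with weight [1 / p], the squared norm of [p] is its mass
    1, its scalar product with [dirac a - p] is the mass 0 of the latter, and
    the squared norm of [dirac a - p] is [1 / p a - 2 + 1]. *)
Lemma mode_orthogonal (p_neq0 : forall g, p g != 0) J K :
  \sum_y mode J y * mode K y / (\prod_i p (y i)) =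
    if J == K then \prod_(i in ~: J) ((p (chi i))^-1 - 1) else 0.
Proof.
pose h (L : {set 'I_n}) i g := if i \in L then p g else (g == chi i)%:R - p g.
pose f i g := h J i g * h K i g / p g.
transitivity (\prod_i \sum_g f i g).
  rewrite -sum_ffun_prod; apply: eq_bigr => y _.
  by rewrite -prodfV -!big_split.
have in_both i : i \in J -> i \in K -> \sum_g f i g = 1.
  move=> iJ iK; rewrite -[RHS]p_sum1; apply: eq_bigr => g _.
  by rewrite /f /h iJ iK mulfK.
have in_one i : (i \in J) != (i \in K) -> \sum_g f i g = 0.
  move=> iJK; rewrite -[RHS](sum_dirac_sub (chi i)); apply: eq_bigr => g _.
  move: iJK; rewrite /f /h; case: (i \in J); case: (i \in K) => // _.
    by rewrite mulrAC mulfV // mul1r.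
  by rewrite mulfK.
have in_none i : i \notin J -> i \notin K -> \sum_g f i g = (p (chi i))^-1 - 1.
  move=> /negPf iJ /negPf iK.
  transitivity (\sum_g (((p g)^-1 - 1) * (g == chi i)%:R -
                        ((g == chi i)%:R - p g))).
    apply: eq_bigr => g _; rewrite /f /h iJ iK; have pg := p_neq0 g.
    by case: (g == chi i) => /=; field.
  by rewrite sumrB sum_eq_mul sum_dirac_sub subr0.
case: eqP => [<-|/eqP JK] in in_none in_one in_both *.
  rewrite (bigID (mem J)) /= big1 => [|i iJ]; last exact: in_both.
  rewrite mul1r; apply: eq_big => [i|i iJ]; first by rewrite !inE.
  exact: in_none.
have [i iJK] : exists i, (i \in J) != (i \in K).
  apply/existsP; rewrite -negb_forall; apply: contraNN JK => /forallP e.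
  by apply/eqP/setP => i; apply/eqP.
by rewrite (bigD1 i) //= in_one // mul0r.
Qed.

End Modes.

(** * The law of the chain in terms of modes *)

Lemma sum_state (R : realFieldType) (G : finGroupType) (n : nat)
    (f : state G n -> R) :
  \sum_w f w = \sum_y \sum_s f (y, s).
Proof. by rewrite pair_bigA; apply: eq_bigr => -[]. Qed.

Section Chain.

Variables (R : realFieldType) (n : nat) (Qhat : aug_perm n -> R).
Implicit Types (J : {set 'I_n}) (s t : 'S_n).

(** The subprobability law of the permutation on the event that the refreshed
    set is contained in [J]; it is [mu_n Qhat J * Q_cond Qhat J] without the
    division, so that no case distinction on the mass is needed. *)
Definition restr_law J s : R :=
  \sum_(u : aug_perm n | (augT u == s) && (augI u \subset J)) Qhat u.

Lemma restr_law_mass J : \sum_s restr_law J s = mu_n Qhat J.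
Proof.
rewrite /mu_n (partition_big (@augT n) xpredT) //=; apply: eq_bigr => s _.
by apply: eq_bigl => u; rewrite andbC.
Qed.

(** Every point moved by the permutation is refreshed. *)
Lemma restr_law_supp J s : s \notin Sym J -> restr_law J s = 0.
Proof.
move=> sJ; rewrite /restr_law big_pred0 // => u; apply/negP => /andP[/eqP Tu].
move=> IJ; case/negP: sJ; rewrite inE; apply: subset_trans IJ.
apply/subsetP => i; rewrite -Tu => moved.
by rewrite /augI !inE; apply/orP; left.
Qed.

Section Kernel.

Variables (G : finGroupType) (p : G -> R) (chi : {ffun 'I_n -> G}).
Hypothesis p_sum1 : \sum_g p g = 1.

Lemma trans_probE (v w : state G n) :
  trans_prob p Qhat v w =
    \sum_(r : aug_perm n | augT r == (w.2 * v.2^-1)%g)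
      Qhat r * refresh p (augI r) v.1 w.1.
Proof.
apply: eq_bigr => r _; rewrite -mulrA; congr (_ * _).
rewrite /refresh [RHS](bigID (mem (augI r))) /=; congr (_ * _).
  by apply: eq_bigr => i ->.
by apply: eq_bigr => i /negPf->.
Qed.

Lemma kstep0 (v w : state G n) : kstep p Qhat 0 v w = (v == w)%:R.
Proof. by rewrite /kstep expr0 mxE (inj_eq enum_rank_inj). Qed.

Lemma kstepS k (v w : state G n) :
  kstep p Qhat k.+1 v w =
    \sum_u kstep p Qhat k v u * trans_prob p Qhat u w.
Proof.
rewrite /kstep exprSr mxE (reindex enum_rank) /=; last first.
  exact/onW_bij/enum_rank_bij.
by apply: eq_bigr => u _; rewrite [trans_mx _ _ _ _]mxE !enum_rankK.
Qed.

(** One step multiplies the permutation by an increment and applies to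
    [mode J] a refreshment, which keeps it or kills it; the increments that keep
    it have law [restr_law J], so the coefficient of [mode J] is convolved with
    this law. *)
Lemma kstep_mode k y s :
  kstep p Qhat k (chi, 1%g) (y, s) =
    \sum_J conv_pow (restr_law J) k s * mode p chi J y.
Proof.
elim: k y s => [|k IHk] y s.
  rewrite kstep0 -mulr_sumr sum_mode_dirac /conv_pow /= xpair_eqE.
  by rewrite eq_sym [1%g == s]eq_sym -natrM mulnb andbC.
rewrite kstepS sum_state.
(* [refresh_mode] is used backwards, so that the truncation of the increments
   by [augI r \subset J] appears as a sum over the previous state. *)
transitivity (\sum_J \sum_t \sum_(r : aug_perm n | augT r == (s * t^-1)%g)
    Qhat r * conv_pow (restr_law J) k t *
      \sum_x mode p chi J x * refresh p (augI r) x y); last first.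
  apply: eq_bigr => J _; rewrite conv_powS mulr_suml; apply: eq_bigr => t _.
  rewrite /restr_law big_mkcondr !mulr_suml; apply: eq_bigr => r _.
  by rewrite refresh_mode //; case: ifP => _; rewrite ?mulr0 ?mul0r.
rewrite exchange_big [RHS]exchange_big /=; apply: eq_bigr => t _.
under eq_bigr => x _ do rewrite IHk trans_probE mulr_suml /=.
rewrite exchange_big /=; apply: eq_bigr => J _.
under eq_bigr do rewrite mulr_sumr.
rewrite exchange_big /=; apply: eq_bigr => r _; rewrite mulr_sumr.
by apply: eq_bigr => x _; ring.
Qed.

Lemma stationary_mode y s :
  stationary p (y, s) = (n`!%:R)^-1 * mode p chi setT y.
Proof.
by rewrite /stationary; congr (_ * _); apply: eq_bigr => i _; rewrite inE.
Qed.

Lemma kstep_mass k : \sum_u Qhat u = 1 ->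
  \sum_w kstep p Qhat k (chi, 1%g) w = 1.
Proof.
move=> Q1.
rewrite sum_state exchange_big /=.
transitivity (\sum_s conv_pow (restr_law setT) k s); last first.
  rewrite conv_pow_mass restr_law_mass /mu_n.
  by rewrite (eq_bigl xpredT) ?Q1 ?expr1n // => u; rewrite subsetT.
apply: eq_bigr => s _; under eq_bigr do rewrite kstep_mode.
rewrite exchange_big /= (bigD1 setT) //=.
rewrite [X in _ + X]big1 ?addr0 => [|J /negPf JT].
  by rewrite -mulr_sumr mode_mass // eqxx mulr1.
by rewrite -mulr_sumr mode_mass // JT mulr0.
Qed.

(** Pythagoras for the orthogonal family of modes; the factor [n!] is the
    inverse of the uniform mass of a permutation. *)
Lemma norm2_mode_expansion (p_neq0 : forall g, p g != 0)
    (a : {set 'I_n} -> 'S_n -> R) :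
  sq_norm2 (@stationary R G n p)
    (fun w => \sum_J a J w.2 * mode p chi J w.1) =
  n`!%:R * \sum_J \prod_(i in ~: J) ((p (chi i))^-1 - 1) *
    \sum_s a J s ^+ 2.
Proof.
rewrite /sq_norm2 sum_state exchange_big /=.
under [X in _ = _ * X]eq_bigr do rewrite mulr_sumr.
rewrite [X in _ = _ * X]exchange_big /= mulr_sumr; apply: eq_bigr => s _.
transitivity (\sum_J \sum_K n`!%:R * a J s * a K s *
   \sum_y mode p chi J y * mode p chi K y / (\prod_i p (y i))); last first.
  rewrite mulr_sumr; apply: eq_bigr => J _; rewrite (bigD1 J) //=.
  rewrite [X in _ + X]big1 ?addr0 => [|K KJ].
    by rewrite mode_orthogonal // eqxx; ring.
  by rewrite mode_orthogonal // eq_sym (negPf KJ) mulr0.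
under [RHS]eq_bigr => J _.
  under eq_bigr do rewrite mulr_sumr.
  rewrite exchange_big /=; over.
rewrite [RHS]exchange_big /=; apply: eq_bigr => y _.
rewrite expr2 !mulr_suml; apply: eq_bigr => J _.
rewrite mulr_sumr mulr_suml; apply: eq_bigr => K _.
by rewrite /stationary invfM invrK /=; ring.
Qed.

End Kernel.

Lemma restr_law_eq0 J s : (forall u, 0 <= Qhat u) -> mu_n Qhat J = 0 ->
  restr_law J s = 0.
Proof.
move=> Q0 /eqP; rewrite psumr_eq0 // => /allP h.
apply: big1 => u /andP[_ uJ]; apply/eqP.
by have := h u (mem_index_enum u); rewrite uJ.
Qed.

Lemma conv_pow_restr_law J k s : mu_n Qhat J != 0 ->
  conv_pow (restr_law J) k s = mu_n Qhat J ^+ k * conv_pow (Q_cond Qhat J) k s.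
Proof.
move=> mu0; rewrite -conv_pow_scale; apply: eq_conv_pow => t.
by rewrite /Q_cond -/(restr_law J t) mulrC divfK.
Qed.

Lemma Q_cond_conv_pow_mass J k : mu_n Qhat J != 0 ->
  \sum_s conv_pow (Q_cond Qhat J) k s = 1.
Proof.
move=> mu0; rewrite conv_pow_mass.
by rewrite -mulr_suml restr_law_mass divff // expr1n.
Qed.

Lemma Q_cond_conv_pow_supp J k s : s \notin Sym J ->
  conv_pow (Q_cond Qhat J) k s = 0.
Proof.
apply: (@conv_pow_supp _ _ (Sym_group J)) => t tJ.
by rewrite /Q_cond -/(restr_law J t) restr_law_supp // mul0r.
Qed.

Lemma sum_in_Q_cond_conv_pow J k : mu_n Qhat J != 0 ->
  \sum_(s in Sym J) conv_pow (Q_cond Qhat J) k s = 1.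
Proof.
move=> mu0; rewrite -[RHS](Q_cond_conv_pow_mass k mu0).
rewrite [RHS](bigID (mem (Sym J))) /=.
by rewrite [X in _ + X]big1 ?addr0 // => s; apply: Q_cond_conv_pow_supp.
Qed.

(** The square distance to the uniform measure, of mass [1 / |J|!] on [Sym J],
    expands to the sum of squares minus [2 / |J|!] plus [1 / |J|!]. *)
Lemma d_E J k : mu_n Qhat J != 0 ->
  d_ Qhat k J =
    #|J|`!%:R * (\sum_s conv_pow (Q_cond Qhat J) k s ^+ 2) - 1.
Proof.
move=> mu0; rewrite /d_ (negPf mu0).
have f0 : #|J|`!%:R != 0 :> R by rewrite pnatr_eq0 -lt0n fact_gt0.
rewrite [X in _ = _ * X - _](bigID (mem (Sym J))) /=.
rewrite [X in _ * (_ + X)]big1 ?addr0; last first.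
  by move=> s sJ; rewrite Q_cond_conv_pow_supp // expr0n.
set q := conv_pow _ k; set c := (#|J|`!%:R)^-1 : R.
transitivity (#|J|`!%:R * (\sum_(s in Sym J) q s ^+ 2 -
    2 * c * (\sum_(s in Sym J) q s) + \sum_(s in Sym J) c ^+ 2)).
  congr (_ * _); rewrite mulr_sumr -sumrB -big_split /=.
  by apply: eq_bigr => s sJ; rewrite /unif_Sym sJ card_Sym -/c; ring.
rewrite sum_in_Q_cond_conv_pow // sumr_const card_Sym -mulr_natl /c; field.
exact: f0.
Qed.

(** If the mass of the restricted law is 0, both sides vanish.  This uses
    [0 < k]: the 0-th power is a Dirac mass whatever the law. *)
Lemma sum_restr_law_sq J k : (forall u, 0 <= Qhat u) -> (0 < k)%N ->
  \sum_s conv_pow (restr_law J) k s ^+ 2 =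
    mu_n Qhat J ^+ (2 * k) * (d_ Qhat k J + 1) / #|J|`!%:R.
Proof.
move=> Q0 k_gt0.
have f0 : #|J|`!%:R != 0 :> R by rewrite pnatr_eq0 -lt0n fact_gt0.
have [mu0|mu0] := eqVneq (mu_n Qhat J) 0.
  case: k k_gt0 => // k _; rewrite mu0 expr0n muln_eq0 !mul0r.
  apply: big1 => s _; rewrite conv_powS big1 ?expr0n // => t _.
  by rewrite restr_law_eq0 // mul0r.
rewrite d_E // subrK mulrCA mulrAC mulfV // mul1r mulr_sumr.
by apply: eq_bigr => s _; rewrite conv_pow_restr_law // exprMn -exprM mulnC.
Qed.

End Chain.

Theorem theorem2p3 (R : realFieldType) (n : nat) (G : finGroupType)
    (p : G -> R) (Qhat : aug_perm n -> R) (chi : {ffun 'I_n -> G})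
    (n_ge1 : (1 <= n)%N)
    (p_prob : is_prob p)
    (p_min_gt0 : 0 < min_mass p)
    (Qhat_prob : is_prob Qhat)
    (Qhat_sym : aug_symmetric Qhat)
    (Q_spread : not_on_proper_coset (imageT Qhat))
    (k : nat) (k_ge1 : (1 <= k)%N) :
  let Pk := kstep p Qhat k (chi, 1%g) in
  let Pinf := @stationary R G n p in
  let norm2 := sq_norm2 Pinf (fun w => Pk w - Pinf w) in
  let c (J : {set 'I_n}) :=
    n`!%:R / #|J|`!%:R * \prod_(i in ~: J) ((p (chi i))^-1 - 1) in
  tv_dist Pk Pinf ^+ 2 <= 4^-1 * norm2 /\
  4^-1 * norm2 =
    4^-1 * (\sum_(J : {set 'I_n})
              c J * mu_n Qhat J ^+ (2 * k) * d_ Qhat k J) +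
    4^-1 * (\sum_(J : {set 'I_n} | J \proper [set: 'I_n])
              c J * mu_n Qhat J ^+ (2 * k)).
Proof.
move=> Pk Pinf norm2 c.
have [_ p1] := p_prob; have [Q0 Q1] := Qhat_prob.
have p_gt0 g : 0 < p g by apply: lt_le_trans p_min_gt0 (bigmin_le _ _ _).
have p_neq0 g : p g != 0 by rewrite gt_eqF.
have f_gt0 : 0 < n`!%:R :> R by rewrite ltr0n fact_gt0.
have f_neq0 : n`!%:R != 0 :> R by rewrite gt_eqF.
have cardSn : #|{: 'S_n}| = n`! by rewrite card_Sn.
split.
  apply: tv_sq_le_norm2; last exact: kstep_mass.
    by move=> w; rewrite mulr_gt0 ?invr_gt0 ?prodr_gt0.
  rewrite /Pinf sum_state exchange_big /=.
  under eq_bigr => s _.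
    under eq_bigr do rewrite (stationary_mode _ chi).
    rewrite -mulr_sumr mode_mass // eqxx mulr1; over.
  by rewrite sumr_const cardSn -[LHS]mulr_natl mulfV.
rewrite -mulrDr; congr (_ * _).
(* The coefficient of [mode J] in [Pk - Pinf]. *)
pose a (J : {set 'I_n}) s :=
  conv_pow (restr_law Qhat J) k s - (J == setT)%:R / n`!%:R.
have -> : norm2 = sq_norm2 Pinf (fun w => \sum_J a J w.2 * mode p chi J w.1).
  apply: eq_bigr => -[y s] _; congr (_ ^+ 2 / _).
  rewrite /Pk /Pinf kstep_mode // (stationary_mode _ chi) /=.
  rewrite [RHS](eq_bigr _ (fun J _ => mulrBl _ _ _)) sumrB; congr (_ - _).
  rewrite [RHS](bigD1 setT) //= eqxx mul1r big1 ?addr0 // => J /negPf->.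
  by rewrite !mul0r.
rewrite norm2_mode_expansion // mulr_sumr.
(* Splitting off the full set: its coefficient is the only one that the
   stationary law alters, and it contributes [d_ Qhat k setT] alone. *)
rewrite (bigD1 setT) //= [in RHS](bigD1 setT) //= -addrA; congr (_ + _).
  have muT : mu_n Qhat setT = 1.
    by rewrite -Q1; apply: eq_bigl => u; rewrite subsetT.
  have -> : \sum_s a setT s ^+ 2 = d_ Qhat k setT / n`!%:R.
    transitivity (\sum_s conv_pow (restr_law Qhat setT) k s ^+ 2
      - 2 / n`!%:R * (\sum_s conv_pow (restr_law Qhat setT) k s)
      + \sum_(s : 'S_n) (n`!%:R)^-1 ^+ 2).
      rewrite mulr_sumr -sumrB -big_split /=; apply: eq_bigr => s _.
      by rewrite /a eqxx mulr1n; ring.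
    rewrite conv_pow_mass restr_law_mass sum_restr_law_sq // muT !expr1n.
    rewrite sumr_const cardSn cardsT card_ord -mulr_natl; field.
    exact: f_neq0.
  rewrite /c muT expr1n cardsT card_ord setCT; field.
  exact: f_neq0.
have prT (J : {set 'I_n}) : (J \proper setT) = (J != setT).
  by rewrite properEneq subsetT andbT.
rewrite (eq_bigl _ _ prT) -big_split /=; apply: eq_bigr => J /negPf JT.
rewrite /c.
under [\sum_s _]eq_bigr do rewrite /a JT mul0r subr0.
rewrite sum_restr_law_sq //; ring.
Qed.
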